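(* Let $X$ be a real Banach space. If $X^*$ is the closed linear span of the w*-SCS points of $B(X^* )$, then $X$ has the Ball Generated Property (BGP).
   Context: All Banach spaces are real; $B(X^* )$ is the closed unit ball of $X^*$. $X$ has the BGP if every closed bounded convex set in $X$ is ball-generated, i.e., an intersection of sets each of which is a finite union of closed balls. A w*-slice of a bounded convex set $K\subseteq X^*$ is a nonempty set of the form $\{f\in K: f(x)>\alpha\}$ with $x\in X$, $\alpha\in\mathbb{R}$. A point $x_0^*$ in a convex set $K\subseteq X^*$ is a w*-SCS point of $K$ if for every $\varepsilon>0$ there exist w*-slices $S_1,\ldots,S_n$ of $K$ and a convex combination $S=\sum_{i=1}^n\lambda_iS_i$ ($\lambda_i\ge0$, $\sum_{i}\lambda_i=1$) such that $x_0^*\in S$ and $\operatorname{diam}(S)<\varepsilon$. *)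

(* Defs.v *)
From HB Require Import structures.
From mathcomp Require Import all_boot all_order all_algebra.
From mathcomp Require Import all_classical all_reals all_analysis.
Import Order.TTheory GRing.Theory Num.Theory.
Import numFieldNormedType.Exports.

Set Implicit Arguments.
Unset Strict Implicit.
Unset Printing Implicit Defensive.

Local Open Scope classical_set_scope.
Local Open Scope ring_scope.

(* [dual X] carries the operator norm, so [closure] and [closed_ball] in it refer
   to the norm topology, not the weak-star one. *)

Section Dual.
Context {R : realType} {X : normedModType R}.

Definition dual_pred : {pred X -> R^o} :=
  [pred f : X -> R^o | `[< linear f /\ continuous f >]].

Record dual : Type := Dual {
  dual_fun :> X -> R^o;
  dual_funP : dual_fun \in dual_pred }.

HB.instance Definition _ := [isSub for dual_fun].
HB.instance Definition _ := [Choice of dual by <:].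

Lemma dual_linear (f : dual) : linear f.
Proof. by have /asboolP[] := dual_funP f. Qed.

Lemma dual_continuous (f : dual) : continuous f.
Proof. by have /asboolP[] := dual_funP f. Qed.

HB.instance Definition _ (f : dual) :=
  GRing.isLinear.Build R X R^o _ f (@dual_linear f).

Lemma dual_submod_closed : submod_closed dual_pred.
Proof.
split.
  apply/asboolP; split; last exact: cst_continuous.
  by move=> a x y; rewrite /GRing.zero/= scaler0 addr0.
move=> a f g /asboolP[lf cf] /asboolP[lg cg]; apply/asboolP; split.
  move=> b x y; rewrite -[LHS]/(a *: f (b *: x + y) + g (b *: x + y)) lf lg.
  rewrite -[RHS]/(b *: (a *: f x + g x) + (a *: f y + g y)).
  rewrite !scalerDr !scalerA (mulrC a b) -!addrA; congr (_ + _).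
  by rewrite addrCA.
by move=> x; apply: cvgD; [apply: cvgZl_tmp; exact: cf|exact: cg].
Qed.

HB.instance Definition _ :=
  GRing.isSubmodClosed.Build R (X -> R^o) dual_pred dual_submod_closed.
HB.instance Definition _ := [SubChoice_isSubLmodule of dual by <:].

Lemma dualDE (f g : dual) x : (f + g) x = f x + g x.
Proof. by []. Qed.

Lemma dualZE a (f : dual) x : (a *: f) x = a * f x.
Proof. by []. Qed.

Definition dual_norm (f : dual) : R := sup [set `|f x| | x in [set x | `|x| <= 1]].

Lemma has_sup_dual_norm (f : dual) :
  has_sup [set `|f x| | x in [set x | `|x| <= 1]].
Proof.
split; first by exists `|f 0|, 0 => //=; rewrite normr0 ler01.
have /bounded_funP/(_ 1)[M fM] : bounded_near f (nbhs (0 : X)).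
  by apply/linear_bounded_continuous; exact: dual_continuous.
by exists M => _ [x /= x1 <-]; exact: fM.
Qed.

Lemma dual_norm_ub (f : dual) (x : X) : `|x| <= 1 -> `|f x| <= dual_norm f.
Proof.
move=> x1; apply: ub_le_sup; last by exists x.
by case: (has_sup_dual_norm f).
Qed.

Lemma dual_norm_le (f : dual) (M : R) :
  (forall x, `|x| <= 1 -> `|f x| <= M) -> dual_norm f <= M.
Proof.
move=> fM; apply: ge_sup; first by case: (has_sup_dual_norm f).
by move=> _ [x /= x1 <-]; exact: fM.
Qed.

Lemma dual_norm_ge0 (f : dual) : 0 <= dual_norm f.
Proof.
by apply: le_trans (dual_norm_ub (x := 0) f _); rewrite ?normr0 ?ler01.
Qed.

Lemma dual_ler_normD (f g : dual) :
  dual_norm (f + g) <= dual_norm f + dual_norm g.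
Proof.
apply: dual_norm_le => x x1; rewrite dualDE.
by rewrite (le_trans (ler_normD _ _))// lerD// dual_norm_ub.
Qed.

Lemma dual_normrZ (a : R) (f : dual) : dual_norm (a *: f) = `|a| * dual_norm f.
Proof.
have dZ b (g : dual) : dual_norm (b *: g) <= `|b| * dual_norm g.
  by apply: dual_norm_le => x x1; rewrite dualZE normrM ler_wpM2l// dual_norm_ub.
apply/eqP; rewrite eq_le dZ/=.
have [->|a0] := eqVneq a 0; first by rewrite normr0 mul0r dual_norm_ge0.
rewrite -ler_pdivlMl ?normr_gt0// -normfV.
by rewrite -{1}(scale1r f) -(mulVf a0) -scalerA dZ.
Qed.

Lemma dual_normr0_eq0 (f : dual) : dual_norm f = 0 -> f = 0.
Proof.
move=> f0; apply/val_inj/funext => x /=; rewrite -[RHS]/(0 : R).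
have [->|x0] := eqVneq x 0; first exact: linear0.
have nx0 : `|x| != 0 by rewrite normr_eq0.
have : `|f (`|x|^-1 *: x)| <= 0.
  by rewrite -f0 dual_norm_ub// normrZ normfV normr_id mulVf.
rewrite normr_le0 linearZ/= mulf_eq0 invr_eq0 (negbTE nx0)/=.
by move/eqP.
Qed.

HB.instance Definition _ := Lmodule_isNormed.Build R dual
  dual_ler_normD dual_normrZ dual_normr0_eq0.

Lemma dual_normE (f : dual) :
  `|f| = sup [set `|f x| | x in [set x | `|x| <= 1]].
Proof. by []. Qed.

End Dual.
Arguments dual {R} X.

Section LinearSpan.
Context {R : realType} {V : normedModType R}.

Definition linear_span (A : set V) : set V :=
  [set v | exists (n : nat) (c : 'I_n -> R) (a : 'I_n -> V),
     (forall i, A (a i)) /\ v = \sum_(i < n) c i *: a i].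

Definition closed_linear_span (A : set V) : set V := closure (linear_span A).

(* The set \sum_i lam_i S_i = {\sum_i lam_i s_i | s_i \in S_i}. *)
Definition sum_of_sets (n : nat) (lam : 'I_n -> R) (S : 'I_n -> set V) : set V :=
  [set v | exists s : 'I_n -> V,
     (forall i, S i (s i)) /\ v = \sum_(i < n) lam i *: s i].

(* Valued in \bar R: +oo on unbounded sets (and -oo on the empty set). *)
Definition diam (S : set V) : \bar R :=
  ereal_sup [set (`|p.1 - p.2|)%:E | p in S `*` S].

End LinearSpan.

Section SmallCombinationOfSlices.
Context {R : realType} {X : normedModType R}.

Definition wstar_slice (K S : set (dual X)) : Prop :=
  S !=set0 /\
  exists (x : X) (alpha : R), S = [set f : dual X | K f /\ alpha < f x].

Definition wstar_SCS_point (K : set (dual X)) (f0 : dual X) : Prop :=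
  K f0 /\
  forall eps : R, 0 < eps ->
    exists (n : nat) (lam : 'I_n -> R) (S : 'I_n -> set (dual X)),
      [/\ forall i, wstar_slice K (S i),
          forall i, 0 <= lam i,
          \sum_(i < n) lam i = 1,
          sum_of_sets lam S f0 &
          (diam (sum_of_sets lam S) < eps%:E)%E].

End SmallCombinationOfSlices.

Section BallGeneratedProperty.
Context {R : realType} {X : normedModType R}.

(* [n = 0] is allowed, so the empty set is a finite union of balls; this only
   matters when [X] is the zero space. *)
Definition finite_union_of_closed_balls (B : set X) : Prop :=
  exists (n : nat) (c : 'I_n -> X) (r : 'I_n -> R),
    (forall i, 0 < r i) /\ B = \bigcup_i closed_ball (c i) (r i).

Definition ball_generated (C : set X) : Prop :=
  exists F : set (set X),
    F `<=` finite_union_of_closed_balls /\ C = \bigcap_(B in F) B.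

End BallGeneratedProperty.

Definition BGP {R : realType} (X : normedModType R) : Prop :=
  forall C : set X,
    closed C -> bounded_set C -> convex_set C -> ball_generated C.

(* Main.v *)
From HB Require Import structures.
Require Import Defs.
From mathcomp Require Import all_boot all_order all_algebra.
From mathcomp Require Import all_classical all_reals all_analysis.
From mathcomp Require Import lra.
Import Order.TTheory GRing.Theory Num.Theory.
Import numFieldNormedType.Exports.
Set Implicit Arguments.
Unset Strict Implicit.
Unset Printing Implicit Defensive.
Local Open Scope classical_set_scope.
Local Open Scope ring_scope.

(** To show that [C] is ball-generated, every point [a] outside [C] has to be
    avoided by some finite union of closed balls containing [C]
    ([ball_separated a C]). Everything rests on one computation with a w*-slice
    [S = {|h| <= 1, h x > al}] of the dual ball. Suppose that [|y| <= M] and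
    that [h y <= - d] for all [h] in [S]. For large [t] the vector [y + t x]
    has norm at most [t |x| - d]: functionals in [S] lose [d] on [y], while
    those outside [S] are at most [t al + M] on [y + t x], and [al < |x|]
    because [S] is nonempty. So such [y] lie in a ball centred at [- t x] that
    misses [0] ([wstar_slice_ball_separated]).

    If [f] is a w*-SCS point and [f y <= - d] with [y] bounded, then all
    functionals of a convex combination of slices of small diameter around [f]
    are still negative at [y], by a fixed amount; since suprema over the slices
    add up, one of the slices must be uniformly negative at [y]. Hence the set
    of such [y] is covered by finitely many balls missing [0], one for each
    slice ([wstar_SCS_ball_separated]).

    For a finite linear combination [g] of w*-SCS points, [g (y - a) >= d]
    forces one of the terms to be at least a fixed positive constant, which
    reduces to the previous case after an affine change of variable
    ([span_ball_separated]). Finally Hahn-Banach gives a functional with [f (y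
    - a) >= d > 0] on [C], and since [C] is bounded, a norm-close [g] in the
    span still separates.

    The Hahn-Banach theorem is obtained from Zorn's lemma in the form: below
    every sublinear functional there is a minimal one, and a minimal sublinear
    functional is linear. The functional [shift_inf] serves twice, once to
    exploit minimality and once to encode separation from a convex set. *)

(** * Infima of real sets *)

Lemma le_infD (R : realType) (A B : set R) (m : R) :
  A !=set0 -> B !=set0 -> (forall a b, A a -> B b -> m <= a + b) ->
  m <= inf A + inf B.
Proof.
move=> A0 B0 mAB; rewrite -lerBlDr; apply: lb_le_inf => // a Aa.
rewrite lerBlDr -lerBlDl; apply: lb_le_inf => // b Bb.
by rewrite lerBlDl mAB.
Qed.

Lemma le_infM (R : realType) (A : set R) (t m : R) :
  0 <= t -> A !=set0 -> (forall a, A a -> m <= t * a) -> m <= t * inf A.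
Proof.
rewrite le_eqVlt => /predU1P[<-|t0] A0 mA.
  by case: A0 => a /mA; rewrite !mul0r.
rewrite -ler_pdivrMl//; apply: lb_le_inf => // a Aa.
by rewrite ler_pdivrMl// mA.
Qed.

(** * Sublinear functionals and the Hahn-Banach theorem *)

Definition sublinear (R : realType) (V : lmodType R) (q : V -> R) : Prop :=
  (forall x y, q (x + y) <= q x + q y) /\
  (forall t x, 0 <= t -> q (t *: x) <= t * q x).

Lemma sublinear_ge (R : realType) (V : lmodType R) (q : V -> R) x :
  sublinear q -> - q (- x) <= q x.
Proof.
move=> [qD qZ]; have := qD x (- x); have := qD 0 0.
by rewrite subrr addr0; lra.
Qed.

(** Convexity in the form used for cones: positive multiples of points of [K]
    add up to a positive multiple of a point of [K]. *)
Definition cone_convex (R : realType) (V : lmodType R) (K : set V) : Prop :=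
  forall s t x y, 0 <= s -> 0 <= t -> K x -> K y ->
    exists2 z, K z & s *: x + t *: y = (s + t) *: z.

Definition shift_values (R : realType) (V : lmodType R) (q : V -> R)
    (K : set V) (d : R) (x : V) : set R :=
  [set r | exists t k, [/\ 0 <= t, K k & r = q (x + t *: k) - t * d]].

(** The largest sublinear functional [r <= q] with [r (- k) <= - d] for all [k]
    in [K], when [K] is convex and [d <= q] on [K]. *)
Definition shift_inf (R : realType) (V : lmodType R) (q : V -> R)
    (K : set V) (d : R) (x : V) : R := inf (shift_values q K d x).

Section ShiftInf.
Context (R : realType) (V : lmodType R) (q : V -> R) (K : set V) (d : R).
Hypotheses (q_sub : sublinear q) (K0 : K !=set0)
  (Kd : forall k, K k -> d <= q k).

Lemma sublinear_pos t k : 0 <= t -> K k -> t * d <= q (t *: k).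
Proof.
move=> t0 Kk; have [_ qZ] := q_sub.
have [->|tn0] := eqVneq t 0.
  have [qD _] := q_sub; have := qD 0 0.
  by rewrite addr0 scale0r mul0r; lra.
have tp : 0 < t by rewrite lt_def tn0.
have := qZ t^-1 (t *: k); rewrite scalerA mulVf// scale1r invr_ge0 => /(_ t0).
rewrite ler_pdivlMl//; apply: le_trans.
by rewrite ler_wpM2l// Kd.
Qed.

(** This bound, which does not depend on [t] and [k], makes the infimum
    finite. *)
Lemma shift_values_lb x : lbound (shift_values q K d x) (- q (- x)).
Proof.
move=> _ [t [k [t0 Kk ->]]]; have [qD _] := q_sub.
have := qD (- x) (x + t *: k); rewrite addKr.
by have := sublinear_pos t0 Kk; lra.
Qed.

Lemma shift_values_neq0 x : shift_values q K d x !=set0.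
Proof. by case: K0 => k Kk; exists (q (x + 0 *: k) - 0 * d), 0, k. Qed.

Lemma shift_inf_le x t k : 0 <= t -> K k ->
  shift_inf q K d x <= q (x + t *: k) - t * d.
Proof.
move=> t0 Kk; apply: ge_inf; last by exists t, k.
by exists (- q (- x)); exact: shift_values_lb.
Qed.

Lemma shift_inf_le_id x : shift_inf q K d x <= q x.
Proof.
case: K0 => k Kk; have := @shift_inf_le x 0 k (lexx _) Kk.
by rewrite scale0r addr0 mul0r subr0.
Qed.

Lemma shift_infN k : K k -> shift_inf q K d (- k) <= - d.
Proof.
move=> Kk; have := @shift_inf_le (- k) 1 k ler01 Kk.
rewrite scale1r mul1r addNr => /le_trans; apply.
by have [_ /(_ 0 0 (lexx _))] := q_sub; rewrite scale0r; lra.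
Qed.

Lemma shift_inf_sublinear : cone_convex K -> sublinear (shift_inf q K d).
Proof.
move=> cK; have [qD qZ] := q_sub; split=> [x y|t x t0].
  apply: le_infD; [exact: shift_values_neq0..|].
  move=> _ _ [s [k [s0 Kk ->]]] [t [l [t0 Kl ->]]].
  have [z Kz zE] := cK s t k l s0 t0 Kk Kl.
  apply: (le_trans (shift_inf_le (x + y) (addr_ge0 s0 t0) Kz)).
  rewrite -zE addrACA; have := qD (x + s *: k) (y + t *: l); lra.
apply: le_infM => //; first exact: shift_values_neq0.
move=> _ [s [k [s0 Kk ->]]].
apply: (le_trans (shift_inf_le (t *: x) (mulr_ge0 t0 s0) Kk)).
by rewrite -scalerA -scalerDr mulrBr mulrA lerB// qZ.
Qed.

End ShiftInf.

(** Of two members of the chain the smaller one serves for both arguments, so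
    subadditivity survives the pointwise infimum; the infimum is finite because
    every [q <= p] satisfies [q x >= - q (- x) >= - p (- x)]. *)
Lemma chain_inf_sublinear (R : realType) (V : lmodType R) (p : V -> R)
    (A : set (V -> R)) :
  A !=set0 -> (forall q, A q -> sublinear q /\ forall x, q x <= p x) ->
  (forall q1 q2, A q1 -> A q2 ->
    (forall x, q1 x <= q2 x) \/ (forall x, q2 x <= q1 x)) ->
  let m x := inf [set q x | q in A] in
  sublinear m /\ forall q, A q -> forall x, m x <= q x.
Proof.
move=> A0 Aq tot m.
have ne x : [set q x | q in A] !=set0 by case: A0 => q ?; exists (q x), q.
have mle q : A q -> forall x, m x <= q x.
  move=> q_A x; apply: ge_inf; last by exists q.
  exists (- p (- x)) => _ [r rA <-]; have [r_sub rp] := Aq _ rA.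
  by apply: le_trans (sublinear_ge x r_sub); rewrite lerN2.
split=> //; split=> [x y|t x t0].
  apply: le_infD => // _ _ [q1 A1 <-] [q2 A2 <-].
  have [[q1D _] _] := Aq _ A1; have [[q2D _] _] := Aq _ A2.
  case: (tot _ _ A1 A2) => q12.
    by have := mle _ A1 (x + y); have := q1D x y; have := q12 y; lra.
  by have := mle _ A2 (x + y); have := q2D x y; have := q12 x; lra.
apply: le_infM => // _ [q q_A <-]; have [[_ qZ] _] := Aq _ q_A.
exact: le_trans (mle _ q_A _) (qZ _ _ t0).
Qed.

Lemma minimal_sublinear (R : realType) (V : lmodType R) (p : V -> R) :
  sublinear p ->
  exists q : V -> R, [/\ sublinear q, forall x, q x <= p x &
    forall r, sublinear r -> (forall x, r x <= q x) -> r = q].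
Proof.
move=> p_sub; pose P q := sublinear q /\ forall x, q x <= p x.
pose below (q1 q2 : {q | P q}) := `[< forall x, sval q2 x <= sval q1 x >].
have [||||[q [q_sub qp]] qmin] := @Zorn {q | P q} below.
- by move=> q; apply/asboolP.
- move=> q1 q2 q3 /asboolP q12 /asboolP q23; apply/asboolP => x.
  exact: le_trans (q23 x) (q12 x).
- move=> [q1 P1] [q2 P2] /asboolP/= q12 /asboolP/= q21.
  have q12E : q1 = q2 by apply/funext => x; apply/eqP; rewrite eq_le q12 q21.
  by rewrite q12E in P1 *; congr exist; exact: Prop_irrelevance.
- move=> A Atot; have [->|/set0P A0] := eqVneq A set0.
    by exists (exist P p (conj p_sub (fun x => lexx (p x)))) => s [].
  have [|||m_sub mle] := @chain_inf_sublinear R V p [set sval q | q in A].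
  + by case: A0 => q Aq; exists (sval q), q.
  + by move=> _ [q _ <-]; case: q.
  + move=> _ _ [q1 A1 <-] [q2 A2 <-].
    by case: (Atot _ _ A1 A2) => /asboolP ?; [right|left].
  + pose m x := inf [set q x | q in [set sval q | q in A]].
    have mp : P m.
      split=> // x; have [q Aq] := A0.
      by apply: le_trans (mle (sval q) _ x) _; [exists q|case: (q) => ? []].
    exists (exist P m mp) => s As; apply/asboolP => x /=.
    by apply: mle; exists s.
exists q; split=> // r r_sub rq.
have rP : P r by split=> // x; exact: le_trans (rq x) (qp x).
by have /(_ (asboolT rq)) [] := qmin (exist P r rP).
Qed.

(** Lowering [q] by [shift_inf] with [K = {y}] and [d = q y] changes nothing, by
    minimality; taking [t = 1] in the infimum then reads
    [q x <= q (x + y) - q y], the missing half of additivity. *)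
Lemma minimal_sublinear_linear (R : realType) (V : lmodType R) (q : V -> R) :
  sublinear q ->
  (forall r, sublinear r -> (forall x, r x <= q x) -> r = q) ->
  linear (q : V -> R^o).
Proof.
move=> q_sub qmin; have [qD qZ] := q_sub.
have q_add x y : q (x + y) = q x + q y.
  apply/eqP; rewrite eq_le qD/=.
  have K0 : [set y] !=set0 by exists y.
  have Kq k : [set y] k -> q y <= q k by move=> ->.
  have y_cone : cone_convex [set y].
    by move=> s t _ _ _ _ -> ->; exists y => //; rewrite scalerDl.
  have q_shift := qmin _ (shift_inf_sublinear q_sub K0 Kq y_cone)
    (shift_inf_le_id q_sub K0 Kq).
  have := @shift_inf_le _ _ _ _ _ q_sub Kq x 1 y ler01 erefl.
  by rewrite q_shift scale1r mul1r; lra.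
have q0 : q 0 = 0 by have := q_add 0 0; rewrite addr0; lra.
have q_opp x : q (- x) = - q x by have := q_add x (- x); rewrite subrr q0; lra.
have q_pos t x : 0 <= t -> q (t *: x) = t * q x.
  move=> t0; apply/eqP; rewrite eq_le qZ//=.
  by have := qZ t (- x) t0; rewrite scalerN !q_opp mulrN lerN2.
move=> t x y; rewrite q_add; congr (_ + _).
have [/q_pos //|/ltW t0] := leP 0 t.
by rewrite -{1}[t]opprK scaleNr q_opp q_pos ?oppr_ge0 // mulNr opprK.
Qed.

Theorem hahn_banach_sublinear (R : realType) (V : lmodType R) (p : V -> R) :
  sublinear p ->
  exists f : V -> R^o, linear f /\ forall x, f x <= p x.
Proof.
move=> /minimal_sublinear[q [q_sub qp qmin]].
by exists q; split=> //; exact: minimal_sublinear_linear.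
Qed.

(** Applying the bound to [- x] as well makes [f] bounded, hence continuous. *)
Lemma dual_of_linear (R : realType) (X : normedModType R) (f : X -> R^o) :
  linear f -> (forall x, f x <= `|x|) ->
  exists2 g : dual X, (forall x, g x = f x) & `|g| <= 1.
Proof.
move=> lf fle.
pose F : {linear X -> R^o} := HB.pack f (GRing.isLinear.Build _ _ _ _ f lf).
have fabs x : `|f x| <= `|x|.
  rewrite ler_norml fle andbT -[f]/(F : X -> R^o) lerNl -linearN.
  by rewrite -[leRHS]normrN fle.
have cf : continuous f.
  apply: (@bounded_linear_continuous _ _ _ F); apply/bounded_funP => r.
  by exists r => x; apply: le_trans (fabs x).
have fP : f \in @dual_pred R X by apply/asboolP.
exists (Dual fP) => //; apply: dual_norm_le => x x1.
exact: le_trans (fabs x) x1.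
Qed.

(** A linear functional below [shift_inf] of the norm is below the norm itself,
    so of norm at most 1, and is at most [- d] on [- K]. *)
Lemma separating_functional (R : realType) (X : normedModType R) (K : set X)
    (d : R) :
  K !=set0 -> cone_convex K -> (forall k, K k -> d <= `|k|) ->
  exists2 f : dual X, `|f| <= 1 & forall k, K k -> d <= f k.
Proof.
move=> K0 cK Kd.
have n_sub : sublinear (fun x : X => `|x|).
  by split=> [x y|t x t0]; [exact: ler_normD|rewrite normrZ ger0_norm].
have [f [lf fp]] := hahn_banach_sublinear (shift_inf_sublinear n_sub K0 Kd cK).
have [|g gf g1] := dual_of_linear lf.
  by move=> x; exact: le_trans (fp x) (shift_inf_le_id n_sub K0 Kd x).
exists g => // k Kk; have gN : g (- k) = - g k := linearN g k.
by rewrite -lerN2 -gN gf; exact: le_trans (fp _) (shift_infN n_sub Kd Kk).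
Qed.

(** Separation of the origin from the single point [x]. *)
Lemma norming_functional (R : realType) (X : normedModType R) (x : X) :
  exists2 f : dual X, `|f| <= 1 & `|x| <= f x.
Proof.
have [| | |f f1 fx] := @separating_functional R X [set x] `|x|.
- by exists x.
- by move=> s t _ _ _ _ -> ->; exists x => //; rewrite scalerDl.
- by move=> _ ->.
- by exists f => //; exact: fx.
Qed.

Lemma dual_le (R : realType) (X : normedModType R) (f : dual X) (x : X) :
  `|f x| <= `|f| * `|x|.
Proof.
have [->|x0] := eqVneq x 0; first by rewrite linear0 !normr0 mulr0.
rewrite -ler_pdivrMr ?normr_gt0//.
have /(_ (`|x|^-1 *: x)) := dual_norm_ub f.
rewrite linearZ /= [_ *: f x]/(_ * f x) !normrM normrZ normfV normr_id.
by rewrite mulVf ?normr_eq0// mulrC; exact.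
Qed.

Lemma dual_ball_le (R : realType) (X : normedModType R) (f : dual X) (x : X) :
  `|f| <= 1 -> f x <= `|x|.
Proof.
move=> f1; apply: le_trans (ler_norm _) (le_trans (dual_le f x) _).
by rewrite ler_piMl.
Qed.

(** * Separation by finite unions of balls *)

Lemma closed_ballP (R : realType) (V : normedModType R) (c y : V) (r : R) :
  0 < r -> closed_ball c r y <-> `|c - y| <= r.
Proof. by move=> r0; rewrite closed_ballE. Qed.

Definition ball_separated (R : realType) (X : normedModType R) (a : X)
    (D : set X) : Prop :=
  exists B, [/\ finite_union_of_closed_balls B, D `<=` B & ~ B a].

Section BallSeparated.
Context (R : realType) (X : normedModType R).
Implicit Types (a : X) (D : set X).

Lemma ball_separatedS a D E : D `<=` E -> ball_separated a E ->
  ball_separated a D.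
Proof.
by move=> DE [B [B_fin EB Ba]]; exists B; split=> //; exact: subset_trans EB.
Qed.

Lemma ball_separated0 a : ball_separated a set0.
Proof.
exists set0; split=> //.
exists 0%N, (fun=> 0), (fun=> 1); split=> [[]//|].
by apply/esym; rewrite -subset0 => x [[]].
Qed.

(** The centres and radii of the two families are concatenated over
    ['I_(m + n)]. *)
Lemma ball_separatedU a D E : ball_separated a D -> ball_separated a E ->
  ball_separated a (D `|` E).
Proof.
move=> [A [[m [c [r [r0 ->]]]] DA Aa]] [B [[n [d [s [s0 ->]]]] EB Ba]].
pose ctr (i : 'I_(m + n)) :=
  match fintype.split i with inl j => c j | inr k => d k end.
pose rad (i : 'I_(m + n)) :=
  match fintype.split i with inl j => r j | inr k => s k end.
exists (\bigcup_i closed_ball (ctr i) (rad i)); split.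
- exists (m + n)%N, ctr, rad; split=> // i.
  by rewrite /rad; case: (fintype.split i) => j.
- move=> x [/DA[j _ jx]|/EB[k _ kx]].
    by exists (lshift n j) => //; rewrite /ctr /rad (unsplitK (inl _ j)).
  by exists (rshift m k) => //; rewrite /ctr /rad (unsplitK (inr _ k)).
- move=> [i _]; rewrite /ctr /rad; case: (fintype.split i) => j ja.
    by apply: Aa; exists j.
  by apply: Ba; exists j.
Qed.

Lemma ball_separated_bigcup a n (D : 'I_n -> set X) :
  (forall i, ball_separated a (D i)) -> ball_separated a (\bigcup_i D i).
Proof.
move=> aD; apply: (@ball_separatedS _ _ (\big[setU/set0]_(i < n) D i)).
  move=> x [i _ Dix]; rewrite -bigcup_seq.
  by exists i => //=; rewrite mem_index_enum.
apply: big_ind => //; [exact: ball_separated0|exact: ball_separatedU].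
Qed.

Lemma ball_separated_ball a D (c : X) (r : R) :
  0 < r -> r < `|c - a| -> (forall y, D y -> `|c - y| <= r) ->
  ball_separated a D.
Proof.
move=> r0 ra Dr; exists (closed_ball c r); split.
- exists 1%N, (fun=> c), (fun=> r); split=> //.
  by apply/seteqP; split=> [y ry|y [i _]//]; exists ord0.
- by move=> y /Dr; rewrite closed_ballE.
- by rewrite closed_ballP// leNgt ra.
Qed.

(** The map [y |-> e (y - a)] multiplies distances by [|e|] and sends [a] to
    [0], so preimages of balls missing [0] are balls missing [a].  Negative [e]
    makes the w*-SCS points usable with coefficients of either sign. *)
Lemma ball_separated_affine a D (e : R) : e != 0 -> ball_separated 0 D ->
  ball_separated a [set y | D (e *: (y - a))].
Proof.
move=> e0 [_ [[n [c [r [r0 ->]]]] DB B0]].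
have er i : 0 < `|e|^-1 * r i by rewrite mulr_gt0// invr_gt0 normr_gt0.
have ballE i y : closed_ball (a + e^-1 *: c i) (`|e|^-1 * r i) y <->
    closed_ball (c i) (r i) (e *: (y - a)).
  rewrite !closed_ballP// ler_pdivlMl ?normr_gt0// -normrZ.
  by rewrite scalerBr scalerDr scalerA divff// scale1r addrAC -scalerBr
    -[a - y]opprB scalerN [- _ + _]addrC.
exists (\bigcup_i closed_ball (a + e^-1 *: c i) (`|e|^-1 * r i)); split.
- by exists n, (fun i => a + e^-1 *: c i), (fun i => `|e|^-1 * r i).
- by move=> y /DB[i _ iy]; exists i => //; apply/ballE.
- by move=> [i _ /ballE]; rewrite subrr scaler0 => i0; apply: B0; exists i.
Qed.

End BallSeparated.

(** * Slices and small combinations of slices *)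

(** The norm of [t x + y] is attained by some [h] in the dual ball, which either
    lies in the slice, where [h y <= - d], or satisfies [h x <= al], where
    [t al + M] is already small. *)
Lemma wstar_slice_ball_separated (R : realType) (X : normedModType R)
    (S : set (dual X)) (M d : R) :
  wstar_slice (closed_ball (0 : dual X) 1) S -> 0 < d ->
  ball_separated 0 [set y : X | `|y| <= M /\ forall h, S h -> h y <= - d].
Proof.
move=> [[h0 Sh0] [x [al SE]]] d0; rewrite {S}SE in Sh0 *.
have ballE (h : dual X) : closed_ball 0 1 h <-> `|h| <= 1.
  by rewrite closed_ballP// sub0r normrN.
have al_x : al < `|x|.
  have [/ballE h01 /lt_le_trans] := Sh0; apply; exact: dual_ball_le.
(* chosen so that [t al + |M| = t |x| - d] *)
pose t := (`|M| + d) / (`|x| - al).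
have t0 : 0 < t by rewrite divr_gt0 ?subr_gt0// ltr_wpDl.
have tE : t * (`|x| - al) = `|M| + d by rewrite divfK// gt_eqF// subr_gt0.
have near_ball y : (`|y| <= M /\ forall h : dual X,
    closed_ball 0 1 h /\ al < h x -> h y <= - d) ->
    `|- (t *: x) - y| <= t * `|x| - d.
  move=> [yM yd]; rewrite -opprD normrN.
  have [h h1 /le_trans] := norming_functional (t *: x + y); apply.
  rewrite linearD linearZ/= -[t *: h x]/(t * h x).
  have [hx|hx] := ltP al (h x).
    have hy := yd h (conj (proj2 (ballE h) h1) hx).
    have : t * h x <= t * `|x| by rewrite ler_pM2l// dual_ball_le.
    lra.
  have hy := dual_ball_le y h1.
  have : t * h x <= t * al by rewrite ler_pM2l.
  have := ler_norm M.
  lra.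
(* Any radius from [t |x| - d] up to, but excluding, [t |x|] works.
   With [d / 2] to spare, a nonpositive radius means that the set is empty. *)
have [r0|r0] := ltP 0 (t * `|x| - d / 2).
  apply: (ball_separated_ball r0 (c := - (t *: x))).
    by rewrite subr0 normrN normrZ gtr0_norm//; lra.
  by move=> y /near_ball /le_trans; apply; lra.
apply: ball_separatedS (ball_separated0 _) => y /near_ball.
by have := normr_ge0 (- (t *: x) - y); lra.
Qed.

Lemma diam_lt_dist (R : realType) (V : normedModType R) (S : set V)
    (e : R) u v :
  S u -> S v -> (diam S < e%:E)%E -> `|u - v| < e.
Proof.
move=> Su Sv; rewrite -lte_fin; apply: le_lt_trans.
by apply: ereal_sup_ubound; exists (u, v).
Qed.

Lemma dual_sum (R : realType) (X : normedModType R) n (c : 'I_n -> R)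
    (h : 'I_n -> dual X) (x : X) :
  (\sum_(i < n) c i *: h i) x = \sum_(i < n) c i * h i x.
Proof.
elim: n c h => [|n IH] c h; first by rewrite !big_ord0.
by rewrite !big_ord_recl -IH.
Qed.

(** Were every slice [S i] to contain some [h i] with [h i y > - d / 2], the
    combination [g] of the [h i] would satisfy [g y >= - d / 2] although it is
    too close to [f] for that. *)
Lemma wstar_SCS_ball_separated (R : realType) (X : normedModType R)
    (f : dual X) (M d : R) :
  wstar_SCS_point (closed_ball (0 : dual X) 1) f -> 0 < d ->
  ball_separated 0 [set y : X | `|y| <= M /\ f y <= - d].
Proof.
move=> [_ f_scs] d0.
have M1 : 0 < `|M| + 1 by rewrite ltr_wpDl.
have d2 : 0 < d / 2 by rewrite divr_gt0.
have e0 : 0 < d / 2 / (`|M| + 1) by rewrite divr_gt0.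
have [n [lam [S [S_slice lam0 lam1 Sf Sd]]]] := f_scs _ e0.
apply: (@ball_separatedS _ _ _ _ (\bigcup_i
    [set y : X | `|y| <= M /\ forall h, S i h -> h y <= - (d / 2)]));
  last first.
  by apply: ball_separated_bigcup => i; exact: wstar_slice_ball_separated.
move=> y [yM fy]; apply: contrapT => ny.
have bad i : exists h, S i h /\ - (d / 2) < h y.
  apply: contrapT => nh; apply: ny; exists i => //; split=> // h Sh.
  by rewrite leNgt; apply/negP => hy; apply: nh; exists h.
have {bad}[h /all_and2[Sh hy]] := choice bad.
pose g := \sum_(i < n) lam i *: h i.
have Sg : sum_of_sets lam S g by exists h.
have gfy : g y - f y <= `|g - f| * `|y|.
  have := dual_le (g - f) y; apply: le_trans; exact: ler_norm.
have gf_small : `|g - f| * `|y| < d / 2.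
  have yM1 : `|y| < `|M| + 1 by have := ler_norm M; lra.
  have := ltr_pM (normr_ge0 _) (normr_ge0 _) (diam_lt_dist Sg Sf Sd) yM1.
  by rewrite divfK// gt_eqF.
have : - (d / 2) <= g y.
  have -> : - (d / 2) = \sum_(i < n) lam i * - (d / 2).
    by rewrite -mulr_suml lam1 mul1r.
  rewrite dual_sum; apply: ler_sum => i _.
  by rewrite ler_wpM2l// ltW.
lra.
Qed.

(** * The ball generated property *)

(** If a sum of [n] terms is at least [d], one of the terms is at least
    [d / n.+1]; the successor also covers the empty sum. *)
Lemma span_ball_separated (R : realType) (X : normedModType R) (g : dual X)
    (a : X) (M d : R) :
  linear_span [set f | wstar_SCS_point (closed_ball (0 : dual X) 1) f] g ->
  0 < d ->
  ball_separated a [set y | `|y - a| <= M /\ d <= g (y - a)].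
Proof.
move=> [n [c [f [f_scs ->]]]] d0.
pose D i := [set y | `|y - a| <= M /\ d / n.+1%:R <= c i * f i (y - a)].
have dn : 0 < d / n.+1%:R by rewrite divr_gt0.
apply: (@ball_separatedS _ _ _ _ (\bigcup_i D i)).
  move=> y [yM]; rewrite dual_sum => dle; apply: contrapT => nD.
  have : \sum_(i < n) c i * f i (y - a) <= \sum_(i < n) d / n.+1%:R.
    apply: ler_sum => i _; rewrite leNgt; apply/negP => /ltW ci.
    by apply: nD; exists i.
  rewrite sumr_const card_ord => /(le_trans dle); apply/negP.
  rewrite -ltNge -[_ / _ *+ n]mulr_natr mulrAC -mulrA gtr_pMr// ltr_pdivrMr//.
  by rewrite mul1r ltr_nat.
apply: ball_separated_bigcup => i.
have [ci|ci] := eqVneq (c i) 0.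
  apply: ball_separatedS (ball_separated0 _) => y [_].
  by rewrite ci mul0r leNgt dn.
have nci : - c i != 0 by rewrite oppr_eq0.
apply: ball_separatedS
  (ball_separated_affine a nci
     (wstar_SCS_ball_separated (`|c i| * M) (f_scs i) dn)) => y [yM cf] /=.
rewrite normrZ normrN ler_wpM2l//; split=> //.
by rewrite scaleNr linearN lerN2 linearZ.
Qed.

Lemma convex_set_shift_cone_convex (R : realType) (X : normedModType R)
    (C : set X) (a : X) :
  convex_set C -> cone_convex [set y - a | y in C].
Proof.
move=> cC s t _ _ s0 t0 [x Cx <-] [y Cy <-].
have [st0|st0] := eqVneq (s + t) 0.
  have /eqP : s + t = 0 by []; rewrite paddr_eq0// => /andP[/eqP-> /eqP->].
  by exists (x - a); [exists x|rewrite addr0 !scale0r addr0].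
have stp : 0 < s + t by rewrite lt_def st0 addr_ge0.
have l0 : 0 <= s / (s + t) by rewrite divr_ge0 ?addr_ge0.
have l1 : s / (s + t) <= 1 by rewrite ler_pdivrMr// mul1r lerDl.
exists (s / (s + t) *: x + t / (s + t) *: y - a).
  exists (s / (s + t) *: x + t / (s + t) *: y) => //.
  have /set_mem := cC x y (Itv01 l0 l1) (mem_set Cx) (mem_set Cy).
  congr (C (_ *: _ + _ *: _)).
  by apply: (mulIf st0); rewrite /= mulrBl mul1r !divfK// addrC addKr.
rewrite [RHS]scalerBr [in RHS]scalerDr !scalerA.
rewrite [_ * (s / _)]mulrC divfK// [_ * (t / _)]mulrC divfK//.
by rewrite !scalerBr addrACA -opprD -scalerDl.
Qed.

Theorem proposition4 (R : realType) (X : completeNormedModType R) :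
  closed_linear_span
    [set f : dual X | wstar_SCS_point (closed_ball (0 : dual X) 1) f]
    = [set: dual X] ->
  BGP X.
Proof.
move=> spanT C C_closed C_bnd C_cvx.
suff sep a : ~ C a -> ball_separated a C.
  exists [set B | finite_union_of_closed_balls B /\ C `<=` B].
  split=> [B []//|]; apply/seteqP; split=> [y Cy B [_]|y yB]; first exact.
  apply: contrapT => /sep[B [B_fin CB By]]; exact: By (yB B _).
move=> aC; have [->|/set0P[y0 Cy0]] := eqVneq C set0.
  exact: ball_separated0.
have [d d0 dC] : exists2 d : R, 0 < d & forall y, C y -> d <= `|y - a|.
  have : nbhs a (~` C).
    by apply: open_nbhs_nbhs; split; first exact: closed_openC.
  move=> /nbhs_ballP[d /= d0 dC]; exists d => // y Cy.
  rewrite leNgt; apply/negP => ya; apply: (dC y _ Cy).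
  by rewrite -ball_normE /ball_/= distrC.
have [M M0 CM] : exists2 M : R, 0 < M & forall y, C y -> `|y - a| <= M.
  have [N [_ CN]] := C_bnd; exists (`|N| + 1 + `|a|) => [|y Cy].
    by rewrite ltr_pwDl// ltr_wpDl.
  apply: le_trans (ler_normB _ _) _; rewrite lerD2r; apply: CN => //.
  by have := ler_norm N; lra.
have [||_ [y Cy <-]|f _ fd] :=
    @separating_functional R X [set y - a | y in C] d.
- by exists (y0 - a), y0.
- exact: convex_set_shift_cone_convex.
- exact: dC.
have e0 : 0 < d / 2 / M by rewrite !divr_gt0.
have [g [g_span fg]] : exists g, linear_span
    [set f : dual X | wstar_SCS_point (closed_ball (0 : dual X) 1) f] g /\
    `|f - g| < d / 2 / M.
  have : closed_linear_span
    [set f : dual X | wstar_SCS_point (closed_ball (0 : dual X) 1) f] f.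
    by rewrite spanT.
  move=> /(_ _ (nbhsx_ballx f _ e0))[g []]; rewrite -ball_normE => gs gf.
  by exists g.
have d2 : 0 < d / 2 by rewrite divr_gt0.
apply: ball_separatedS (span_ball_separated a M g_span d2) => y Cy; split.
  exact: CM.
have fy : d <= f (y - a) by apply: fd; exists y.
have : (f - g) (y - a) <= d / 2.
  apply: le_trans (ler_norm _) (le_trans (dual_le _ _) _).
  rewrite -[d / 2](divfK (lt0r_neq0 M0)).
  by apply: ler_pM => //; [exact: ltW|exact: CM].
by rewrite -[(f - g) _]/(f (y - a) - g (y - a)); lra.
Qed.
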